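(* For each $\wp \in (1, \infty)$ there exists a finite leaf metric space $(L,d)$ of generalized roundness $\wp$.
   Context: A metric tree is a connected graph $(T,E)$ without cycles or loops in which each edge $e \in E$ is assigned a positive length $|e|$; the distance $d_T(x,y)$ between two vertices $x,y \in T$ is the sum of the lengths of the edges on the unique minimal geodesic from $x$ to $y$. The tree is discrete if there is a constant $c > 0$ such that $|e| > c$ for all $e \in E$. A metric $d$ on a set $X$ is a leaf metric (and $(X,d)$ is a leaf metric space) if there exists a discrete metric tree $(T,E,d_T)$ such that $X$ is contained in the set of all leaves of $T$ and $d(x,y) = d_T(x,y)$ for all $x,y \in X$. A real number $p \ge 0$ is a generalized roundness exponent of a metric space $(X,d)$ if for all integers $n > 0$ and all choices of (not necessarily distinct) points $a_1, \ldots, a_n, b_1, \ldots, b_n \in X$ we have $\sum_{1 \le k < l \le n} \{ d(a_k,a_l)^p + d(b_k,b_l)^p \} \le \sum_{1 \le j,i \le n} d(a_j,b_i)^p$. The generalized roundness of $(X,d)$ is the supremum (in $[0,\infty]$) of the set of all generalized roundness exponents of $(X,d)$. For $p=0$ the convention $0^0 = 0$ is used for distances. *)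

(* Defs.v *)
From HB Require Import structures.
From mathcomp Require Import all_boot all_order all_algebra.
From mathcomp Require Import all_classical all_reals all_analysis.

Set Implicit Arguments.
Unset Strict Implicit.
Unset Printing Implicit Defensive.

Import Order.TTheory GRing.Theory Num.Theory.

Local Open Scope classical_set_scope.
Local Open Scope ring_scope.

Section MetricTree.
Variable R : realType.

(* Edges are unordered, so the edge length only matters, and is only required
   to be symmetric, on adjacent pairs. In a simple graph [ucycle] also holds of
   the degenerate walks x, y, x along a single edge (size 2), hence the bound. *)
Record metric_tree := MetricTree {
  vertex :> choiceType;
  adj : rel vertex;
  edge_length : vertex -> vertex -> R;
  adj_sym : symmetric adj;
  adj_loopless : irreflexive adj;
  adj_connected : forall x y, exists p, path adj x p /\ last x p = y;
  adj_acyclic : forall c, ucycle adj c -> (size c <= 2)%N;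
  edge_length_sym :
    forall x y, adj x y -> edge_length x y = edge_length y x;
  edge_length_gt0 : forall x y, adj x y -> 0 < edge_length x y }.

Variable T : metric_tree.
Implicit Types (x y : T) (p q : seq T).

Definition walk x y p := path (@adj T) x p /\ last x p = y.

Definition walk_length x p : R := \sum_(r <- pairmap (@edge_length T) x p) r.

Definition geodesic x y p :=
  walk x y p /\ forall q, walk x y q -> walk_length x p <= walk_length x q.

(* In a tree there is exactly one geodesic from x to y, so the default value
   of [xget] is never used. *)
Definition tree_dist x y : R := walk_length x (xget [::] (geodesic x y)).

Definition leaf x := exists! y, adj x y.

Definition discrete_tree :=
  exists2 c : R, 0 < c & forall x y, adj x y -> c < edge_length x y.

End MetricTree.

(* The inclusion of X in the set of leaves is an injection. *)
Definition leaf_metric_space (R : realType) (X : metricType R) :=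
  exists (T : metric_tree R) (f : X -> T),
    [/\ discrete_tree T,
        injective f,
        forall x, leaf (f x)
      & forall x y, mdist x y = tree_dist (f x) (f y)].

(* MathComp has 0 `^ 0 = 1, whereas for distances 0 ^ 0 = 0. *)
Definition dist_pow (R : realType) (r p : R) : R :=
  if r == 0 then 0 else r `^ p.

Definition roundness_exponent (R : realType) (X : metricType R) (p : R) :=
  0 <= p /\
  forall (n : nat) (a b : 'I_n -> X), (0 < n)%N ->
    \sum_(k < n) \sum_(l < n | (k < l)%N)
      (dist_pow (mdist (a k) (a l)) p + dist_pow (mdist (b k) (b l)) p)
    <= \sum_(j < n) \sum_(i < n) dist_pow (mdist (a j) (b i)) p.

Definition generalized_roundness (R : realType) (X : metricType R) : \bar R :=
  ereal_sup [set p%:E | p in [set p : R | roundness_exponent X p]].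

(* Main.v *)
Require Import Defs.
From HB Require Import structures.
From mathcomp Require Import all_boot all_order all_algebra.
From mathcomp Require Import all_classical all_reals all_analysis.
From mathcomp Require Import ring lra.

(** The space is a regular simplex together with one extra point. Take a star
    with [m + 1] edges, [m] of them of length [a / 2] and the last of length
    [1 - a / 2], where [1 < a < 2]. Its leaves are [m] vertices at mutual
    distance [a] and an apex at distance [1] from each of them.

    The vertices balanced against [m] copies of the apex test the exponent [q]:
    the inequality reads [m (m - 1) a^q / 2 <= m^2], that is
    [a^q <= 2 m / (m - 1)]. This suggests choosing [a] with
    [a^p = 2 m / (m - 1)], and then it rules out every [q > p]
    ([simplex_roundness_exponent_le]). The constraint [a < 2] says that
    [2 m / (m - 1) < 2^p]; as [p > 1], it holds for [m] large
    ([exists_simplex_side]).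

    Conversely [p] is an exponent, because the [p]-th powers of the distances
    are squared Euclidean distances: the simplex is a regular one of
    circumradius [1], whose squared side is indeed [2 m / (m - 1)], and the apex
    sits at its centre. Squared Euclidean distances always satisfy the
    roundness inequality, as its two sides then differ by the squared norm
    of the difference between the sum of the [a_k] and that of the [b_k]
    ([sum_sqr_diff_roundness], [roundness_exponent_sqr_embedding]). *)

Set Implicit Arguments.
Unset Strict Implicit.
Unset Printing Implicit Defensive.

Import Order.TTheory GRing.Theory Num.Theory.

Local Open Scope classical_set_scope.
Local Open Scope ring_scope.

(** * Distances in trees *)

(** Two geodesics with the same ends have the same length, since each is
    minimal; so it does not matter which one the distance picks. *)
Lemma tree_dist_geodesic (R : realType) (T : metric_tree R) (x y : T) p :
  geodesic x y p -> tree_dist x y = walk_length x p.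
Proof.
move=> geo_p; rewrite /tree_dist.
have [walk_g min_g] := xgetI [::] geo_p.
by have [walk_p min_p] := geo_p; apply/le_anti; rewrite min_g ?min_p.
Qed.

(** Bounds the length of all walks at once: to show that a walk is geodesic it
    is enough to find a [d] that takes its length as value at its two ends. *)
Lemma le_walk_length (R : realType) (T : metric_tree R) (d : T -> T -> R) :
    (forall x, d x x = 0) ->
    (forall y x z, d x z <= d x y + d y z) ->
    (forall x y, adj x y -> d x y <= edge_length x y) ->
  forall x p, path (@adj R T) x p -> d x (last x p) <= walk_length x p.
Proof.
move=> dxx tri d_edge x p; elim: p x => [|y p IHp] x /=.
  by rewrite dxx /walk_length big_nil.
case/andP=> xy yp; rewrite /walk_length big_cons.
by apply: le_trans (tri y _ _) _; apply: lerD; [exact: d_edge | exact: IHp].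
Qed.

(** * Stars *)

(** Also gives the distance between vertices of a star, for [r] the distance to
    the centre. *)
Definition star_dist (R : realType) (T : eqType) (r : T -> R) (x y : T) : R :=
  if x == y then 0 else r x + r y.

Section StarDist.
Context {R : realType} {T : eqType} (r : T -> R).
Hypothesis r_ge0 : forall x, 0 <= r x.

Lemma star_distxx x : star_dist r x x = 0.
Proof. by rewrite /star_dist eqxx. Qed.

Lemma star_dist_sym x y : star_dist r x y = star_dist r y x.
Proof. by rewrite /star_dist eq_sym addrC. Qed.

Lemma star_dist_triangle y x z :
  star_dist r x z <= star_dist r x y + star_dist r y z.
Proof.
have := r_ge0 x; have := r_ge0 y; have := r_ge0 z; rewrite /star_dist.
case: (x =P z) => [<-|xz]; first by rewrite eq_sym; case: eqP => _; lra.
case: (x =P y) xz => [<-|_] xz; first by case: eqP xz => // _ _; lra.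
by case: (y =P z) => [<-|_]; lra.
Qed.

End StarDist.

(** The parameter [r] of this alias of [I] is what determines the metric. *)
Definition star_leaves (R : realType) (I : choiceType) (r : I -> {posnum R}) :
  Type := I.

Section StarMetric.
Context {R : realType} {I : choiceType} (r : I -> {posnum R}).

Let dist : star_leaves r -> star_leaves r -> R :=
  star_dist (fun i : I => (r i)%:num).

Let dist_eq0 x y : dist x y = 0 -> x = y.
Proof.
rewrite /dist /star_dist; case: eqP => // _ /eqP.
by rewrite gt_eqF.
Qed.

Let dist_triangle y x z : dist x z <= dist x y + dist y z.
Proof. exact: star_dist_triangle. Qed.

HB.instance Definition _ := Choice.on (star_leaves r).
HB.instance Definition _ := @isMetric.Build R (star_leaves r) dist
  (star_distxx _) dist_eq0 (star_dist_sym _) dist_triangle.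

Lemma mdist_star (x y : star_leaves r) :
  mdist x y = if x == y then 0 else (r x)%:num + (r y)%:num.
Proof. by []. Qed.

End StarMetric.

Section StarTree.
Context {R : realType} {I : choiceType} (r : I -> {posnum R}).

(** The centre of the star is [None], and its leaves are the [Some i]. *)
Definition star_adj : rel (option I) := fun x y => isSome x != isSome y.

Definition star_radius (x : option I) : R :=
  if x is Some i then (r i)%:num else 0.

Let star_radius_ge0 x : 0 <= star_radius x.
Proof. by case: x => /=. Qed.

Let star_adj_sym : symmetric star_adj.
Proof. by move=> x y; rewrite /star_adj eq_sym. Qed.

Let star_adj_loopless : irreflexive star_adj.
Proof. by move=> x; rewrite /star_adj eqxx. Qed.

Let star_adj_connected x y : exists p, path star_adj x p /\ last x p = y.
Proof.
case: x y => [i|] [j|].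
- by exists [:: None; Some j].
- by exists [:: None].
- by exists [:: Some j].
- by exists [::].
Qed.

Let star_adj_acyclic c : ucycle star_adj c -> (size c <= 2)%N.
Proof.
(* Adjacent vertices are never both leaves, so a closed walk visits the centre
   every other step; with three vertices or more it does so twice. *)
case: c => [|x [|y [|z s]]] // /andP[].
by case: x y z s => [i|] [j|] [k|] [|[l|] s] //=; rewrite andbF.
Qed.

Let star_edge_sym x y :
  star_adj x y -> star_radius x + star_radius y = star_radius y + star_radius x.
Proof. by rewrite addrC. Qed.

Let star_edge_gt0 x y : star_adj x y -> 0 < star_radius x + star_radius y.
Proof. by case: x y => [i|] [j|] //= _; rewrite ?addr0 ?add0r. Qed.

Definition star_tree : metric_tree R :=
  MetricTree star_adj_sym star_adj_loopless star_adj_connected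
    star_adj_acyclic star_edge_sym star_edge_gt0.

Lemma tree_dist_star (x y : star_tree) :
  tree_dist x y = star_dist star_radius x y.
Proof.
suff [p walk_p len_p] : exists2 p, walk x y p &
    walk_length x p = star_dist star_radius x y.
  rewrite -len_p; apply: tree_dist_geodesic; split=> // q [adj_q last_q].
  rewrite len_p -[y in star_dist _ _ y]last_q.
  apply: le_walk_length adj_q => [z|u z w|z w zw].
  - exact: star_distxx.
  - exact: star_dist_triangle.
  - by rewrite /star_dist; case: eqP => [->|//] /=; rewrite addr_ge0.
case: (x =P y) => [<-|].
  by exists [::]; rewrite ?star_distxx /walk_length ?big_nil.
rewrite /star_dist /walk_length; case: x y => [i|] [j|] // neq.
- exists [:: None; Some j] => //; rewrite !big_cons big_nil/=.
  by case: eqP neq => //= _ _; rewrite !addr0 add0r.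
- by exists [:: None] => //; rewrite !big_cons big_nil/= !addr0.
- by exists [:: Some j] => //; rewrite !big_cons big_nil/= !addr0.
Qed.

End StarTree.

Lemma star_leaf_metric_space (R : realType) (I : finType) (r : I -> {posnum R}) :
  leaf_metric_space (star_leaves r).
Proof.
exists (star_tree r), (@Some I); split.
- pose c := \big[Order.min/1]_i (r i)%:num.
  have c_gt0 : 0 < c by apply: lt_bigmin => //.
  have c_le i : c <= (r i)%:num by exact: bigmin_le_cond.
  exists (c / 2); first by rewrite divr_gt0.
  case=> [i|] [j|] //= _; [have := c_le i | have := c_le j]; lra.
- exact: Some_inj.
- by move=> i; exists None; split=> // -[j|].
- move=> i j; rewrite tree_dist_star mdist_star /star_dist /=.
  by rewrite (inj_eq Some_inj).
Qed.

(** * Roundness exponents and Euclidean embeddings *)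

Lemma sum_lt_sym (R : realType) n (f : 'I_n -> 'I_n -> R) :
    (forall k l, f k l = f l k) -> (forall k, f k k = 0) ->
  2 * (\sum_(k < n) \sum_(l < n | (k < l)%N) f k l) =
  \sum_(k < n) \sum_(l < n) f k l.
Proof.
move=> f_sym f_diag.
have -> : \sum_(k < n) \sum_(l < n) f k l =
    \sum_(k < n) \sum_(l < n | (k < l)%N) f k l +
    \sum_(k < n) \sum_(l < n | (l < k)%N) f k l.
  rewrite -big_split; apply: eq_bigr => k _ /=.
  rewrite (bigID (fun l : 'I_n => (k < l)%N)) /=; congr (_ + _).
  rewrite (bigID (fun l : 'I_n => (l < k)%N)) /= [X in _ + X]big1 ?addr0.
    by apply: eq_bigl => l; case: ltngtP.
  move=> l; rewrite -!leqNgt => /andP[le_lk le_kl].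
  by rewrite (_ : l = k) ?f_diag //; apply/val_inj/anti_leq/andP.
rewrite mulr_natl mulr2n; congr (_ + _).
rewrite (exchange_big_dep xpredT) //=.
by apply: eq_bigr => k _; apply: eq_bigr => l _.
Qed.

Lemma sum_sqr_diff (R : realType) n (x y : 'I_n -> R) :
  \sum_(k < n) \sum_(l < n) (x k - y l) ^+ 2 =
  n%:R * (\sum_k x k ^+ 2 + \sum_k y k ^+ 2) - 2 * (\sum_k x k) * \sum_k y k.
Proof.
transitivity
    (\sum_(k < n) (n%:R * x k ^+ 2 - 2 * x k * (\sum_l y l) + \sum_l y l ^+ 2)).
  apply: eq_bigr => k _.
  under eq_bigr do rewrite sqrrB.
  rewrite !big_split /= sumr_const card_ord sumrN sumrMnl -mulr_sumr.
  by rewrite mulr_natl -[_ *+ 2]mulr_natl mulrA.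
rewrite !big_split /= sumr_const card_ord sumrN -!mulr_sumr -mulr_suml.
by rewrite -mulr_sumr -[_ *+ n]mulr_natl; ring.
Qed.

(** What the roundness inequality becomes for squared distances on the line,
    with its defect: weighting the [x k] by [1] and the [y k] by
    [-1] makes the total weight vanish, so in the weighted double sum of the
    squared differences only the square of the weighted sum remains. *)
Lemma sum_sqr_diff_roundness (R : realType) n (x y : 'I_n -> R) :
  \sum_(j < n) \sum_(i < n) (x j - y i) ^+ 2 =
  \sum_(k < n) \sum_(l < n | (k < l)%N) ((x k - x l) ^+ 2 + (y k - y l) ^+ 2) +
  (\sum_k x k - \sum_k y k) ^+ 2.
Proof.
set S := \sum_(k < n) \sum_(l < n | (k < l)%N) _.
have : 2 * S = \sum_(k < n) \sum_(l < n) ((x k - x l) ^+ 2 + (y k - y l) ^+ 2).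
  by apply: sum_lt_sym => [k l|k]; ring.
under [X in _ = X -> _]eq_bigr do rewrite big_split.
rewrite big_split /= !sum_sqr_diff => eqS.
by apply: (@mulfI _ 2) => //; rewrite [RHS]mulrDr eqS; ring.
Qed.

(** The easy half of Schoenberg's criterion: the [phi j] are the coordinates of
    a Euclidean embedding, and the inequality holds on each of them. *)
Lemma roundness_exponent_sqr_embedding (R : realType) (X : metricType R)
    (J : finType) (c p : R) (phi : J -> X -> R) :
    0 <= p -> 0 <= c ->
    (forall x y, dist_pow (mdist x y) p = c * \sum_j (phi j x - phi j y) ^+ 2) ->
  roundness_exponent X p.
Proof.
move=> p_ge0 c_ge0 dE; split=> // n a b _.
under eq_bigr do under eq_bigr do rewrite !dE -mulrDr -big_split.
under [leRHS]eq_bigr do under eq_bigr do rewrite dE.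
under eq_bigr do rewrite -mulr_sumr exchange_big.
under [leRHS]eq_bigr do rewrite -mulr_sumr exchange_big.
rewrite -!mulr_sumr ler_wpM2l // exchange_big [leRHS]exchange_big /=.
apply: ler_sum => j _.
by rewrite (sum_sqr_diff_roundness (phi j \o a) (phi j \o b)) lerDl sqr_ge0.
Qed.

(** * The pointed simplex *)

Lemma powR_le_inj (R : realType) (a p q : R) :
  1 < a -> a `^ q <= a `^ p -> q <= p.
Proof.
move=> a_gt1 le_aqp; have a_gt0 : 0 < a by apply: lt_trans a_gt1.
move: le_aqp; rewrite -[_ `^ q <= _]ler_ln ?posrE ?powR_gt0// !ln_powR.
by rewrite ler_pM2r ?ln_gt0.
Qed.

Lemma sum_delta_sqr (R : realType) (J : finType) (i : J) (t : R) :
  \sum_j ((j == i)%:R - t) ^+ 2 = 1 - 2 * t + #|J|%:R * t ^+ 2.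
Proof.
rewrite (bigD1 i) //= eqxx.
rewrite (eq_bigr (fun=> t ^+ 2)); last first.
  by move=> j /negPf->; rewrite sub0r sqrrN.
rewrite sumr_const cardC1 -[_ *+ _]mulr_natl.
have : (0 < #|J|)%N by apply/card_gt0P; exists i.
by case: #|J| => // n _; rewrite /= -[in RHS]natr1; ring.
Qed.

Lemma sum_delta_diff_sqr (R : realType) (J : finType) (i k : J) :
  \sum_j ((j == i)%:R - (j == k)%:R) ^+ 2 = if i == k then 0 else 2 :> R.
Proof.
case: eqP => [->|/eqP neq_ik]; first by rewrite big1 // => j _; rewrite subrr expr0n.
have neq_ki : k != i by rewrite eq_sym.
rewrite (bigD1 i) // (bigD1 k) //= !eqxx (negPf neq_ik) (negPf neq_ki).
rewrite big1 => [|j /andP[/negPf-> /negPf->]]; last by rewrite subrr expr0n.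
by rewrite subr0 sub0r sqrrN expr1n addr0.
Qed.

(** With [m = n + 2] vertices, [2 m / (m - 1) = 2 (1 + 1 / (n + 1))] tends to
    [2] from above, hence it is eventually below [2^p]. *)
Lemma exists_simplex_side (R : realType) (p : R) : 1 < p ->
  exists (n : nat) (a : R),
    [/\ 1 < a, a < 2 & a `^ p = 2 * n.+2%:R / n.+1%:R].
Proof.
move=> p_gt1; have p_gt0 : 0 < p by apply: lt_trans p_gt1.
have : 1 < 2 `^ p / 2 :> R.
  rewrite ltr_pdivlMr // mul1r -[ltLHS](powRr1 (ltW _)) //.
  by rewrite ltNge; apply/negP => /powR_le_inj; rewrite ltr1n leNgt p_gt1 => /(_ isT).
case/ltr_add_invr=> n; rewrite ltr_pdivlMr // => side_lt.
pose A : R := 2 * n.+2%:R / n.+1%:R.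
have A_eq : A = (1 + n.+1%:R^-1) * 2.
  by rewrite /A -[n.+2%:R]natr1; field; rewrite addrC natr1 pnatr_eq0.
have n_gt0 : 0 < n.+1%:R^-1 :> R by rewrite invr_gt0.
have A_gt1 : 1 < A by rewrite A_eq; move: n_gt0; set u := _^-1; lra.
have A_gt0 : 0 < A by lra.
have aE : (A `^ p^-1) `^ p = A by rewrite -powRrM mulVf ?gt_eqF// powRr1 ?ltW.
exists n, (A `^ p^-1); split=> //.
- have := @gt0_ltr_powR _ p^-1; rewrite invr_gt0 => /(_ p_gt0 1 A).
  by rewrite !nnegrE powR1 => -> //; lra.
- rewrite ltNge; apply/negP => /(ge0_ler_powR (ltW p_gt0)).
  rewrite !nnegrE powR_ge0 ler0n aE => /(_ isT isT).
  by rewrite leNgt A_eq side_lt.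
Qed.

Section PointedSimplex.
Context {R : realType} (n : nat) (a p : R).
Hypotheses (a_gt1 : 1 < a) (a_lt2 : a < 2) (p_gt0 : 0 < p).
Hypothesis a_pow : a `^ p = 2 * n.+2%:R / n.+1%:R.

Let side_gt0 : 0 < a / 2.
Proof. by rewrite divr_gt0 // (lt_trans ltr01). Qed.

Let rest_gt0 : 0 < 1 - a / 2.
Proof. by rewrite subr_gt0 ltr_pdivrMr // mul1r. Qed.

(** The apex is [None]; the tree of this star adds one more [None], the centre,
    which is not a point of the space. *)
Definition simplex_radius (x : option 'I_n.+2) : {posnum R} :=
  if x is Some _ then PosNum side_gt0 else PosNum rest_gt0.

Let L : metricType R := star_leaves simplex_radius.

Lemma dist_pow_simplex q (x y : L) : q != 0 ->
  dist_pow (mdist x y) q =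
  if x == y then 0 else if x && y then a `^ q else 1.
Proof.
move=> q_neq0; rewrite mdist_star /dist_pow; case: (x =P y); rewrite ?eqxx //.
case: x y => [i|] [j|] //= _.
- by rewrite -splitr gt_eqF // (lt_trans ltr01).
- by rewrite addrC subrK oner_eq0 powR1.
- by rewrite subrK oner_eq0 powR1.
Qed.

Lemma simplex_roundness_exponent : roundness_exponent L p.
Proof.
(* The vertices of the standard simplex, translated so that their centroid is
   0, where the apex goes. They have squared norm 1 - 1 / m there, which c
   rescales to 1. *)
pose phi (j : 'I_n.+2) (x : L) : R :=
  if x is Some i then (j == i)%:R - n.+2%:R^-1 else 0.
pose c : R := n.+2%:R / n.+1%:R.
have c_sqr : c * (1 - n.+2%:R^-1) = 1.
  by rewrite /c -[n.+2%:R]natr1; field; rewrite !(addrC 1) !natr1 !pnatr_eq0.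
apply: (@roundness_exponent_sqr_embedding _ _ _ c _ phi).
- exact: ltW.
- exact: divr_ge0.
have c_vertex i : c * \sum_j (phi j (Some i) - phi j None) ^+ 2 = 1.
  rewrite -[RHS]c_sqr; congr (_ * _); rewrite /phi.
  under eq_bigr do rewrite subr0.
  by rewrite sum_delta_sqr card_ord; field; rewrite -natrD pnatr_eq0.
move=> x y; rewrite dist_pow_simplex ?gt_eqF//.
case: x y => [i|] [j|] /=.
- under eq_bigr do rewrite opprB addrA subrK.
  rewrite sum_delta_diff_sqr (inj_eq Some_inj) a_pow /c.
  by case: eqP => _; [rewrite mulr0 | rewrite [RHS]mulrC mulrA].
- exact/esym/c_vertex.
- under eq_bigr do rewrite -sqrrN opprB.
  exact/esym/c_vertex.
- by rewrite big1 ?mulr0 // => j _; rewrite subrr expr0n.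
Qed.

Lemma simplex_roundness_exponent_le q : roundness_exponent L q -> q <= p.
Proof.
case=> q_ge0 /(_ n.+2 (fun k => Some k) (fun=> None) isT).
have [q_gt0 | /le_trans-> //] := ltP 0 q; last exact: ltW.
have q_neq0 : q != 0 by rewrite gt_eqF.
under eq_bigr do under eq_bigr do rewrite !dist_pow_simplex // eqxx addr0.
under [leRHS]eq_bigr do under eq_bigr do rewrite dist_pow_simplex //.
rewrite -(ler_pM2l (ltr0Sn R 1)) sum_lt_sym => [|k l|k]; last 2 first.
- by rewrite eq_sym.
- by rewrite eqxx.
under [leLHS]eq_bigr => k _.
  rewrite (bigD1 k) //= eqxx add0r.
  rewrite (eq_bigr (fun=> a `^ q)); last first.
    by move=> l lk; rewrite (inj_eq Some_inj) eq_sym (negPf lk).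
  rewrite sumr_const cardC1 card_ord -[_ *+ _]mulr_natl.
  over.
rewrite [leLHS]sumr_const; under [X in 2 * X]eq_bigr do rewrite sumr_const.
rewrite sumr_const !card_ord -[leLHS]mulr_natl -[X in 2 * X]mulr_natl.
move=> le_q; apply: powR_le_inj a_gt1 _.
rewrite a_pow ler_pdivlMr //.
have n2_gt0 : 0 < n.+2%:R :> R by [].
rewrite -(ler_pM2l n2_gt0).
by rewrite [_ * n.+1%:R]mulrC [n.+2%:R * (2 * _)]mulrCA.
Qed.

Lemma generalized_roundness_simplex : generalized_roundness L = p%:E.
Proof.
apply/le_anti/andP; split.
  apply: ge_ereal_sup => _ [q /= exp_q <-].
  by rewrite lee_fin; apply: simplex_roundness_exponent_le.
apply: ereal_sup_ubound; exists p => //.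
exact: simplex_roundness_exponent.
Qed.

End PointedSimplex.

Theorem theorem4p5 (R : realType) (p : R) (hp : 1 < p) :
  exists L : metricType R,
    [/\ finite_set [set: L],
        leaf_metric_space L
      & generalized_roundness L = p%:E].
Proof.
have [n [a [a_gt1 a_lt2 a_pow]]] := exists_simplex_side hp.
exists (star_leaves (simplex_radius a_gt1 a_lt2 : option 'I_n.+2 -> _)); split.
- exact: (@finite_finset (option 'I_n.+2)).
- exact: star_leaf_metric_space.
- exact: generalized_roundness_simplex (lt_trans ltr01 hp) a_pow.
Qed.
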